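(* Let $(M,d)$ be a metric space and $X$ a Banach space. Let $\alpha\geq 0$ and let $\varphi:M\to 2^{X}$ be a correspondence such that $\varphi(a)$ is non-empty, closed and convex for every $a\in M$, and such that $\varphi$ admits local strongly pointwise $\alpha$-Lipschitz selections. If $\varphi$ has a continuous selection, then, for every $\beta>\alpha$, there exists a continuous selection of $\varphi$ that is pointwise $\beta$-Lipschitz on a dense set of $M$. If $\varphi$ has a bounded continuous selection, then, for every $\beta>\alpha$, there exists a bounded continuous selection of $\varphi$ that is pointwise $\beta$-Lipschitz on a dense set of $M$.
   Context: A correspondence from a set $A$ to a set $B$ is a set-valued map $\varphi:A\to 2^{B}$. A selection of $\varphi$ is a function $f:A\to B$ with $f(a)\in\varphi(a)$ for all $a\in A$. Let $(M,d)$ and $(M',d')$ be metric spaces and let $\mathbf{B}_M(b,r)=\{a\in M : d(a,b)\le r\}$ denote the closed ball. Let $f:M\to M'$ be a map and $\alpha\ge 0$. - $f$ is pointwise $\alpha$-Lipschitz at $b\in M$ if $\limsup_{r\to 0^+}\left(r^{-1}\sup\{d'(f(b),f(a)) : a\in \mathbf{B}_M(b,r)\}\right)\le\alpha$. It is pointwise $\alpha$-Lipschitz on a set $S\subseteq M$ if this holds at every point of $S$. - $f$ is strongly pointwise $\alpha$-Lipschitz at $b\in M$ if $d'(f(b),f(a))\le\alpha\, d(b,a)$ for all $a\in M$. A correspondence $\varphi:M\to 2^{M'}$ admits local strongly pointwise $\alpha$-Lipschitz selections at $b\in M$ if, for every $y\in\varphi(b)$, there exist an open neighborhood $U\subseteq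 M$ of $b$ and a continuous selection $f:M\to M'$ of $\varphi$ with $f(b)=y$ such that the restriction $f|_U:U\to M'$ is strongly pointwise $\alpha$-Lipschitz at $b$ (as a map on the metric space $U$). It admits local strongly pointwise $\alpha$-Lipschitz selections if it does so at every point of $M$. *)

(* Defs.v *)
From HB Require Import structures.
From mathcomp Require Import all_boot all_order all_algebra.
From mathcomp Require Import all_classical all_reals all_analysis.

Set Implicit Arguments.
Unset Strict Implicit.
Unset Printing Implicit Defensive.

Import Order.TTheory GRing.Theory Num.Theory.
Import numFieldNormedType.Exports.

Local Open Scope classical_set_scope.
Local Open Scope ring_scope.

Definition is_selection (A B : Type) (phi : A -> set B) (f : A -> B) : Prop :=
  forall a, phi a (f a).

(* The library's closed_ball is the closure of the open ball, which may be
   strictly smaller in a general metric space. *)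
Definition metric_closed_ball (R : realType) (M : metricType R) (b : M) (r : R)
  : set M := [set a | mdist a b <= r].

(* Maps below take values in a normed space, whose distance is written with the
   norm because normedModType does not inherit from metricType. *)

(* The supremum is taken in \bar R: it is +oo when f is unbounded on the ball. *)
Definition pointwise_lipschitz_at (R : realType) (M : metricType R)
    (X : normedModType R) (alpha : R) (f : M -> X) (b : M) : Prop :=
  (limf_esup
     (fun r : R => (r^-1)%:E *
        ereal_sup [set `|f b - f a|%:E | a in metric_closed_ball b r])
     (0 : R)^'+ <= alpha%:E)%E.

Definition pointwise_lipschitz_on (R : realType) (M : metricType R)
    (X : normedModType R) (alpha : R) (f : M -> X) (S : set M) : Prop :=
  forall b, S b -> pointwise_lipschitz_at alpha f b.

(* The restriction of f to the metric subspace U is strongly pointwise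
   alpha-Lipschitz at b; only used for b in U. *)
Definition strongly_pointwise_lipschitz_within (R : realType) (M : metricType R)
    (X : normedModType R) (alpha : R) (U : set M) (f : M -> X) (b : M) : Prop :=
  forall a, U a -> `|f b - f a| <= alpha * mdist b a.

Definition local_strongly_pointwise_lipschitz_selections_at (R : realType)
    (M : metricType R) (X : normedModType R) (alpha : R) (phi : M -> set X)
    (b : M) : Prop :=
  forall y, phi b y ->
    exists (U : set M) (f : M -> X),
      [/\ open_nbhs b U, continuous f, is_selection phi f, f b = y
        & strongly_pointwise_lipschitz_within alpha U f b].

Definition local_strongly_pointwise_lipschitz_selections (R : realType)
    (M : metricType R) (X : normedModType R) (alpha : R) (phi : M -> set X)
  : Prop :=
  forall b, local_strongly_pointwise_lipschitz_selections_at alpha phi b.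

(* Main.v *)
Require Import Defs.
From HB Require Import structures.
From mathcomp Require Import all_boot all_order all_algebra.
From mathcomp Require Import all_classical all_reals all_analysis.
From mathcomp Require Import lra.

Set Implicit Arguments.
Unset Strict Implicit.
Unset Printing Implicit Defensive.

Import Order.TTheory GRing.Theory Num.Theory.
Import numFieldNormedType.Exports.

Local Open Scope classical_set_scope.
Local Open Scope ring_scope.

(* Let D_0 = set0 and let D_n increase through maximal 2^-n-separated subsets
   of M. Given a continuous selection f_n, alter it only on small balls around
   the points c of D_(n+1) \ D_n: these balls are disjoint and far from D_n, so
   there f_n can be interpolated by convexity with a local selection g_c such
   that g_c(c) = f_n(c), the ball being so small that f_n moves by at most
   (beta - alpha) 2^-(n+1) min(1, d(-, D_n)). The limit f is a continuous
   selection. A point b that enters at stage n is never moved again, f_n is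
   strongly pointwise alpha-Lipschitz near b, and all later alterations add up
   to at most (beta - alpha) d(-, b): so f is beta-Lipschitz at b. *)

(** * Dependent choice and estimates for sequences *)

Lemma dependent_choice_nat (T : Type) (P : nat -> T -> Prop)
    (Q : nat -> T -> T -> Prop) (x0 : T) :
  P 0%N x0 ->
  (forall n x, P n x -> exists y, P n.+1 y /\ Q n x y) ->
  exists u : nat -> T,
    u 0%N = x0 /\ forall n, P n (u n) /\ Q n (u n) (u n.+1).
Proof.
move=> P0 PQ.
have /choice[s sP] : forall p : nat * T, exists y,
    P p.1 p.2 -> P p.1.+1 y /\ Q p.1 p.2 y.
  move=> [n x] /=; have [/PQ[y Hy]|nP] := pselect (P n x); first by exists y.
  by exists x.
pose u := fix u n := if n is m.+1 then s (m, u m) else x0.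
have Pu n : P n (u n) by elim: n => // n /(sP (n, _))[].
by exists u; split => // n; split => //; have [] := sP (n, u n) (Pu n).
Qed.

Lemma convex_set_segment (R : realType) (V : lmodType R) (A : set V)
    (x y : V) (t : R) :
  convex_set A -> A x -> A y -> 0 <= t <= 1 -> A (x + t *: (y - x)).
Proof.
move=> cA Ax Ay /andP[t0 t1].
have := cA y x (Itv01 t0 t1) (mem_set Ay) (mem_set Ax); rewrite inE.
by congr A; rewrite /conv/= /unstable.onem scalerBr scalerBl scale1r addrCA
  addrA.
Qed.

Lemma geometric_increments (R : realType) (V : normedModType R)
    (u : nat -> V) (C : R) (n : nat) : 0 <= C ->
  (forall k, (n <= k)%N -> `|u k.+1 - u k| <= C * 2^-1 ^+ k.+1) ->
  forall k, (n <= k)%N -> `|u k - u n| <= C * 2^-1 ^+ n.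
Proof.
move=> C0 uC k /subnKC <-; move: (k - n)%N => {k} j.
(* The bare bound [C * 2^-1 ^+ n] is not inductive; subtracting the tail of the geometric series
   leaves exactly the room for the next increment. *)
suff : `|u (n + j)%N - u n| <= C * (2^-1 ^+ n - 2^-1 ^+ (n + j)).
  move/le_trans; apply; rewrite ler_wpM2l// gerBl exprn_ge0// invr_ge0//.
elim: j => [|j IH]; first by rewrite addn0 !subrr normr0 mulr0.
have := uC (n + j)%N (leq_addr _ _); rewrite addnS exprS => uj.
rewrite -(subrKA (u (n + j)%N)) (le_trans (ler_normD _ _))//.
by rewrite (le_trans (lerD uj IH))//; lra.
Qed.

Lemma lim_norm_sub_le (R : realType) (V : normedModType R)
    (u : nat -> V) (l a : V) (C : R) (n : nat) :
  u k @[k --> \oo] --> l -> (forall k, (n <= k)%N -> `|u k - a| <= C) ->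
  `|l - a| <= C.
Proof.
move=> ul uC; apply: (@closed_cvg _ _ \oo _ _ [set x | `|x - a| <= C] _ _ l ul).
  rewrite (_ : [set _ | _] = (fun x => `|x - a|) @^-1` [set x | x <= C])//.
  apply: closed_comp; last exact: closed_le.
  by move=> x _; apply: cvg_norm; apply: cvgB; [exact: cvg_id|exact: cvg_cst].
by exists n.
Qed.

(** * Bump functions and maximal separated sets *)

Section metric_space.
Context {R : realType} {M : metricType R}.
Implicit Types (c x y : M) (D : set M) (e r : R).

Lemma mdist_continuous c : continuous (mdist c : M -> R).
Proof.
move=> x; apply/cvgrPdist_lt => e e0; apply/nbhs_ballP; exists e => //= y.
rewrite ballEmdist /= => xye.
have := metric_triangle c x y; have := metric_triangle c y x.
rewrite (metric_sym y x) => h1 h2.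
by rewrite ltr_norml; apply/andP; split; lra.
Qed.

Lemma bump_function c r : 0 < r -> exists t : M -> R,
  [/\ continuous t, forall x, 0 <= t x <= 1,
      forall x, mdist c x < r / 2 -> t x = 1
    & forall x, r <= mdist c x -> t x = 0].
Proof.
move=> r0; exists ((cst 1 : M -> R) \min
  ((cst 0 : M -> R) \max (fun x => 2 - mdist c x * (2 / r)))).
have r'0 : 0 < 2 / r by rewrite divr_gt0.
split => [|x|x xr|x rx] /=.
- apply: min_fun_continuous; first by move=> ?; exact: cvg_cst.
  apply: max_fun_continuous; first by move=> ?; exact: cvg_cst.
  move=> x; apply: cvgB; first exact: cvg_cst.
  by apply: cvgMl; exact: mdist_continuous.
- by rewrite le_min ge_min lexx le_max lexx ler01.
- have : mdist c x * (2 / r) <= 1.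
    by rewrite mulrA ler_pdivrMr// mul1r -ler_pdivlMr// ltW.
  by move=> h; rewrite min_l// le_max; apply/orP; right; lra.
- have : 2 <= mdist c x * (2 / r).
    by rewrite mulrCA ler_peMr// ler_pdivlMr// mul1r.
  by move=> h; rewrite max_l ?min_r//; lra.
Qed.

Definition separated e D :=
  forall x y, D x -> D y -> mdist x y < e -> x = y.

(** A point at distance at least [e] from a maximal separated set could be added to it, so
    maximality yields the covering property. *)
Lemma maximal_separated e D : 0 < e -> separated e D ->
  exists D', [/\ D `<=` D', separated e D'
                & forall x, exists2 c, D' c & mdist c x < e].
Proof.
move=> e0 sD.
(* Zorn's lemma is applied to the sets added to [D]: the union of the empty chain is then
   admissible, by separation of [D] itself. *)
have [F FP totF|A [sA maxA]] := @Zorn_bigcup _ [set A | separated e (D `|` A)].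
  move=> x y [Dx|[A FA Ax]] [Dy|[B FB By]] xy.
  - exact: sD.
  - by apply: (FP _ FB) => //; [left|right].
  - by apply: (FP _ FA) => //; [right|left].
  - by case: (totF _ _ FA FB) => [/(_ _ Ax)|/(_ _ By)] h;
      [apply: (FP _ FB)|apply: (FP _ FA)] => //; right.
exists (D `|` A); split => //.
move=> x; apply: contrapT => nx.
have far c : (D `|` A) c -> e <= mdist c x.
  by move=> DAc; rewrite leNgt; apply/negP => cx; apply: nx; exists c.
apply: (maxA (A `|` [set x])).
  split; first exact: subsetUl.
  move=> /(_ x (or_intror erefl)) Ax.
  by have := far x (or_intror Ax); rewrite mdistxx leNgt e0.
rewrite /mkset setUA => y z [DAy|->] [DAz|->] //.
- exact: sA.
- by rewrite ltNge far.
- by rewrite metric_sym ltNge far.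
Qed.

Lemma separated_le e e' D : e' <= e -> separated e D -> separated e' D.
Proof. by move=> ee' sD x y Dx Dy /lt_le_trans-/(_ _ ee'); exact: sD. Qed.

End metric_space.

(** * Modification of a continuous selection *)

Section selections.
Context {R : realType} {M : metricType R} {X : normedModType R}.
Context {alpha : R} {phi : M -> set X}.
Hypothesis phi_convex : forall a, convex_set (phi a).
Hypothesis phi_local : local_strongly_pointwise_lipschitz_selections alpha phi.
Implicit Types (f : M -> X) (c : M) (e r : R).

(** A bump [t] at [c] interpolates between [f] and a local selection [g] through [f c]. The change
    is small because [g - f] is continuous and vanishes at [c]; near [c] the result is [g], hence
    the Lipschitz bound. *)
Lemma selection_modification_at f c r e :
  0 < r -> 0 < e -> continuous f -> is_selection phi f ->
  exists h : M -> X,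
    [/\ continuous h, is_selection phi h,
        forall x, r <= mdist c x -> h x = f x,
        forall x, `|h x - f x| <= e
      & exists2 s, 0 < s
          & strongly_pointwise_lipschitz_within alpha (ball c s) h c].
Proof.
move=> r0 e0 fC fphi.
have [U [g [/open_nbhs_nbhs/nbhs_ballP[s /= s0 sU] gC gphi gc glip]]] :=
  phi_local (fphi c).
have gfC : continuous (fun x => g x - f x).
  by move=> x; apply: cvgB; [exact: gC|exact: fC].
have /cvgrPdist_lt/(_ _ e0)/nbhs_ballP[q /= q0 qe] := gfC c.
(* [r] confines the change to the prescribed ball, and [q] ensures that [g - f] is below [e]
   wherever [t] is nonzero. *)
pose p := Num.min r q.
have p0 : 0 < p by rewrite lt_min r0.
have [t [tC t01 t1 t0]] := bump_function c p0.
exists (fun x => f x + t x *: (g x - f x)); split => [x|x|x rx|x|].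
- by apply: cvgD; [exact: fC|apply: cvgZ; [exact: tC|exact: gfC]].
- exact: convex_set_segment.
- by rewrite t0 ?scale0r ?addr0// ge_min rx.
- rewrite addrC addKr normrZ; have [xp|px] := ltP (mdist c x) p; last first.
    by rewrite t0// normr0 mul0r ltW.
  have /andP[tx0 tx1] := t01 x.
  have : ball c q x.
      by rewrite ballEmdist/=; move: xp; rewrite lt_min => /andP[].
  move/qe; rewrite gc subrr sub0r normrN => /ltW; apply: le_trans.
  by rewrite ger0_norm// ler_piMl.
- exists (Num.min s (p / 2)); first by rewrite lt_min s0 divr_gt0.
  move=> x; rewrite ballEmdist /= lt_min => /andP[xs xp].
  rewrite !t1// ?mdistxx ?divr_gt0// !scale1r !subrKC.
  by apply/glip/sU; rewrite ballEmdist.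
Qed.

(** One stage of the recursion: the changes at all new points, those of [D'] outside [D], are glued
    together. *)
Lemma selection_modification f (D D' : set M) e d :
  0 < e -> 0 < d -> D `<=` D' -> separated e D' ->
  continuous f -> is_selection phi f ->
  exists g : M -> X,
    [/\ continuous g, is_selection phi g,
        forall x, `|g x - f x| <= d,
        forall b x, D b -> `|g x - f x| <= d * mdist b x
      & forall c, D' c -> ~ D c -> exists2 s, 0 < s
          & strongly_pointwise_lipschitz_within alpha (ball c s) g c].
Proof.
move=> e0 d0 DD' sD' fC fphi.
(* The bound [d * (e / 2)] serves the estimate relative to [D]: a point within [e / 4] of a new
   centre is more than [e / 2] away from [D]. *)
have eps0 : 0 < Num.min d (d * (e / 2)) by rewrite lt_min d0 mulr_gt0 ?divr_gt0.
have e4 : 0 < e / 4 by rewrite divr_gt0.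
have /choice[h hP] c := selection_modification_at c e4 eps0 fC fphi.
have hC c : continuous (h c) by case: (hP c).
have hphi c : is_selection phi (h c) by case: (hP c).
have h_far c x : e / 4 <= mdist c x -> h c x = f x.
  by case: (hP c) => ? ? + *; apply.
have h_near c x : `|h c x - f x| <= Num.min d (d * (e / 2)) by case: (hP c).
pose near_new x c := [/\ D' c, ~ D c & mdist c x < e / 4].
pose g x := if pselect (exists c, near_new x c) is left ex
            then h (projT1 (cid ex)) x else f x.
(* As [3 / 4 * e + e / 4 = e], separation forces any centre chosen for [x] to be [c]; if there is
   none, both sides are [f x]. *)
have gh c x : D' c -> ~ D c -> mdist c x < 3 / 4 * e -> g x = h c x.
  move=> D'c nDc cx; rewrite /g; case: pselect => [ex|nex].
    case: cid => c' [D'c' _ c'x] /=; congr (h _ x); apply: sD' => //.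
    have := metric_triangle c' x c; rewrite (metric_sym x c) => tri.
    by apply: le_lt_trans tri _; lra.
  rewrite h_far// leNgt; apply/negP => cx'; apply: nex; exists c; split => //.
have gf x : ~ (exists c, near_new x c) -> g x = f x.
  by rewrite /g; case: pselect.
have gcase x : g x = f x \/ exists c, near_new x c /\ g x = h c x.
  rewrite /g; case: pselect => [ex|]; last by left.
  by right; case: cid => c Hc; exists c.
exists g; split => [x|x|x|b x Db|c D'c nDc].
(* The balls of radius e / 4 being e / 2 apart, g agrees near any point with f
   or with a single h c. *)
- have [[c [D'c nDc cx]]|nex] := pselect
      (exists c, [/\ D' c, ~ D c & mdist c x < e / 2]).
    have gE : \forall y \near x, h c y = g y.
      apply/nbhs_ballP; exists (e / 4) => //= y; rewrite ballEmdist /= => xy.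
      rewrite (gh c)//; apply: le_lt_trans (metric_triangle c x y) _; lra.
    rewrite /continuous_at (gh c)//; last by lra.
    exact: cvg_trans (near_eq_cvg gE) (hC c x).
  have gE y : mdist x y < e / 4 -> g y = f y.
    move=> xy; apply: gf => -[c [D'c nDc cy]]; apply: nex.
    exists c; split => //; apply: le_lt_trans (metric_triangle c y x) _.
    by rewrite (metric_sym y x); lra.
  rewrite /continuous_at gE ?mdistxx//.
  apply: cvg_trans (fC x); apply: near_eq_cvg.
  apply/nbhs_ballP; exists (e / 4) => //= y; rewrite ballEmdist /= => xy.
  by rewrite gE.
- by have [->|[c [_ ->]]] := gcase x; [exact: fphi|exact: hphi].
- have [->|[c [_ ->]]] := gcase x; first by rewrite subrr normr0 ltW.
  by apply: le_trans (h_near c x) _; rewrite ge_min lexx.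
- have [->|[c [[D'c nDc cx] ->]]] := gcase x.
    by rewrite subrr normr0 mulr_ge0// ?mdist_ge0// ltW.
  have cb : e <= mdist b c.
    rewrite leNgt; apply/negP => /(sD' _ _ (DD' _ Db) D'c) bc.
    by apply: nDc; rewrite -bc.
  apply: le_trans (h_near c x) _; rewrite ge_min; apply/orP; right.
  rewrite ler_pM2l//; have := metric_triangle b x c.
  by rewrite (metric_sym x c) => tri; lra.
- have [_ _ _ _ [s s0 hlip]] := hP c.
  exists (Num.min s (e / 4)); first by rewrite lt_min s0.
  move=> x; rewrite ballEmdist /= lt_min => /andP[xs xe].
  rewrite !(gh c)// ?mdistxx//; last 2 first; [lra|lra|].
  by apply: hlip; rewrite ballEmdist.
Qed.

End selections.

(** * The limit selection and its Lipschitz points *)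

(** The upper limit is an infimum over neighbourhoods of suprema, so the single neighbourhood of
    radii below [s] suffices: there the closed ball of radius [r] lies in [ball b s]. *)
Lemma pointwise_lipschitz_at_ball (R : realType) (M : metricType R)
    (X : normedModType R) (beta : R) (f : M -> X) (b : M) (s : R) :
  0 < s -> 0 <= beta ->
  strongly_pointwise_lipschitz_within beta (ball b s) f b ->
  pointwise_lipschitz_at beta f b.
Proof.
move=> s0 beta0 flip; apply: ge_ereal_inf.
exists (ereal_sup [set ((r^-1)%:E *
  ereal_sup [set `|f b - f a|%:E | a in metric_closed_ball b r])%E
  | r in `]0, s[%classic]).
  exists `]0, s[%classic => //; near=> r; rewrite /= in_itv/=.
  by apply/andP; split; near: r; [exact: nbhs_right_gt|exact: nbhs_right_lt].
apply: ge_ereal_sup => _ [r /= + <-]; rewrite in_itv/= => /andP[r0 rs].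
rewrite lee_pdivrMl//; apply: ge_ereal_sup => _ [a /= abr <-].
rewrite lee_fin mulrC; apply: le_trans (flip a _) _.
  by rewrite ballEmdist /= metric_sym; exact: le_lt_trans rs.
by rewrite ler_wpM2l// metric_sym.
Unshelve. all: by end_near. Qed.

(** The uniform distance to [f0] is recorded so that boundedness passes from [f0] to the new
    selection. *)
Lemma dense_lipschitz_selection (R : realType) (M : metricType R)
    (X : completeNormedModType R) (alpha beta : R) (phi : M -> set X)
    (f0 : M -> X) :
  0 <= alpha -> alpha < beta ->
  (forall a, closed (phi a)) -> (forall a, convex_set (phi a)) ->
  local_strongly_pointwise_lipschitz_selections alpha phi ->
  continuous f0 -> is_selection phi f0 ->
  exists f : M -> X,
    [/\ continuous f, is_selection phi f,
        forall x, `|f x - f0 x| <= beta - alpha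
      & exists S : set M, dense S /\ pointwise_lipschitz_on beta f S].
Proof.
move=> alpha0 ab phi_closed phi_convex phi_local f0C f0phi.
pose e n : R := 2^-1 ^+ n.
have e0 n : 0 < e n by rewrite exprn_gt0// invr_gt0.
have eS n : e n.+1 <= e n by rewrite /e exprS ler_piMl ?exprn_ge0//; lra.
have e1 n : e n <= 1 by rewrite exprn_ile1//; lra.
pose C := beta - alpha; have C0 : 0 < C by rewrite subr_gt0.
(* The state of the recursion is the pair of the separated set and the current selection; [P] is the
   invariant and [Q] the relation between consecutive stages. *)
pose P n (p : set M * (M -> X)) :=
  [/\ separated (e n) p.1, continuous p.2 & is_selection phi p.2].
pose Q n (p q : set M * (M -> X)) :=
  [/\ p.1 `<=` q.1,
      forall x, exists2 c, q.1 c & mdist c x < e n.+1,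
      forall x, `|q.2 x - p.2 x| <= C * e n.+1,
      forall b x, p.1 b -> `|q.2 x - p.2 x| <= C * e n.+1 * mdist b x
    & forall c, q.1 c -> ~ p.1 c -> exists2 s, 0 < s
        & strongly_pointwise_lipschitz_within alpha (ball c s) q.2 c].
have [||u [u0 uPQ]] := @dependent_choice_nat _ P Q (set0, f0).
- by split => //= x y [].
- move=> n [D f] [/= sD fC fphi].
  have [D' [DD' sD' D'x]] :=
    maximal_separated (e0 n.+1) (separated_le (eS n) sD).
  have [g [gC gphi gd gD glip]] := selection_modification phi_convex phi_local
    (e0 n.+1) (mulr_gt0 C0 (e0 n.+1)) DD' sD' fC fphi.
  by exists (D', g).
pose D n := (u n).1; pose F n := (u n).2.
have FC n : continuous (F n) by case: (uPQ n) => -[].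
have Fphi n : is_selection phi (F n) by case: (uPQ n) => -[].
have FS n x : `|F n.+1 x - F n x| <= C * e n.+1.
  by case: (uPQ n) => _ [_ _ + _ _]; apply.
have FSD n b x : D n b -> `|F n.+1 x - F n x| <= C * e n.+1 * mdist b x.
  by case: (uPQ n) => _ [_ _ _ + _]; apply.
have Dle m n : (m <= n)%N -> D m `<=` D n.
  move=> /subnKC <-; elim: (n - m)%N => [|j IH]; first by rewrite addn0.
  by apply: subset_trans IH _; rewrite addnS; case: (uPQ (m + j)%N) => _ [].
have Fge n k x : (n <= k)%N -> `|F k x - F n x| <= C * e n.
  apply: (@geometric_increments _ _ (F ^~ x)) => [|j _]; first exact: ltW.
  exact: FS.
(* Since [b] stays in every later [D j], each later increment carries the factor [mdist b x], which
   is absorbed into the constant of the geometric bound. *)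
have FgeD n k b x : D n b -> (n <= k)%N ->
    `|F k x - F n x| <= C * mdist b x * e n.
  move=> Dnb; apply: (@geometric_increments _ _ (F ^~ x)) => [|j nj].
    by rewrite mulr_ge0 ?mdist_ge0// ltW.
  by rewrite mulrAC; apply: FSD; exact: Dle Dnb.
have Ce0 : C * e n @[n --> \oo] --> (0 : R).
  rewrite -(mulr0 C); apply: cvgMr; apply: cvg_expr.
  by rewrite ger0_norm ?invr_ge0//; lra.
have F_cvg x : cvg (F n x @[n --> \oo]).
  apply/cauchy_cvgP/cauchy_exP => d d0.
  have /cvgrPdist_lt/(_ _ d0)[n _ /(_ n (leqnn n))] := Ce0.
  rewrite /= sub0r normrN => nd; exists (F n x); exists n => // k /= nk.
  rewrite -ball_normE /= distrC.
  by apply: le_lt_trans (Fge _ _ x nk) _; exact: le_lt_trans (ler_norm _) nd.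
pose f x := lim (F n x @[n --> \oo]).
have fE n x : `|f x - F n x| <= C * e n.
  by apply: lim_norm_sub_le (F_cvg x) _ => k; exact: Fge.
have fED n b x : D n b -> `|f x - F n x| <= C * mdist b x.
  move=> Db; apply: (@le_trans _ _ (C * mdist b x * e n)).
    by apply: lim_norm_sub_le (F_cvg x) _ => k; exact: FgeD.
  by rewrite ler_piMr// mulr_ge0 ?mdist_ge0// ltW.
exists f; split.
(* Continuity of a uniform limit, with the error split into thirds. *)
- move=> x; apply/cvgrPdist_lt => d d0.
  have d3 : 0 < d / 3 by rewrite divr_gt0.
  have /cvgrPdist_lt/(_ _ d3)[n _ /(_ n (leqnn n))] := Ce0.
  rewrite /= sub0r normrN => /(le_lt_trans (ler_norm _)) nd.
  have /cvgrPdist_lt/(_ _ d3) := FC n x; apply: filterS => y Fxy.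
  have := fE n x; have := fE n y; rewrite (distrC (f y)) => fy fx.
  rewrite -(subrKA (F n x)) (le_lt_trans (ler_normD _ _))//.
  have := ler_normD (F n x - F n y) (F n y - f y); rewrite subrKA => h.
  by lra.
- move=> x; apply: (@closed_cvg _ _ \oo _ (F ^~ x) _ (phi_closed x)) (F_cvg x).
  by exists 0%N => // n _; exact: Fphi.
- by move=> x; have := fE 0%N x; rewrite /F u0 /e expr0 mulr1.
exists (\bigcup_n D n); split.
  move=> O [x Ox] Oopen.
  have /nbhs_ballP[d /= d0 dO] : nbhs x O by exact: open_nbhs_nbhs.
  (* Once [e n < d], the covering by [D n.+1] puts one of its points into the ball around [x]. *)
  have /cvgrPdist_lt/(_ _ (mulr_gt0 C0 d0))[n _ /(_ n (leqnn n))] := Ce0.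
  rewrite /= sub0r normrN => /(le_lt_trans (ler_norm _)); rewrite ltr_pM2l//.
  move=> nd.
  have [c Dc cx] : exists2 c, D n.+1 c & mdist c x < e n.+1.
    by case: (uPQ n) => _ [_ + _ _ _]; apply.
  exists c; split; last by exists n.+1.
  apply: dO; rewrite ballEmdist /= metric_sym.
  exact: lt_trans (lt_le_trans cx (eS n)) nd.
move=> b [n _ Dnb].
(* The stage at which [b] enters exists because [D 0] is empty. *)
have [m [D'b Db]] : exists m, D m.+1 b /\ ~ D m b.
  elim: n Dnb => [|n IH] Dnb; first by move: Dnb; rewrite /D u0.
  by have [/IH|nD] := pselect (D n b); last by exists n.
have [_ [_ _ _ _ /(_ b D'b Db) [s s0 Flip]]] := uPQ m.
apply: (@pointwise_lipschitz_at_ball _ _ _ _ _ _ s) => //.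
  by rewrite ltW// (le_lt_trans alpha0).
(* The estimate [fED] at [x = b] has right-hand side zero. *)
move=> a sa; have fb : f b = F m.+1 b.
  have := fED _ _ b D'b; rewrite mdistxx mulr0 normr_le0 subr_eq0.
  by move/eqP.
rewrite -(subrKA (F m.+1 a)) (le_trans (ler_normD _ _))// fb.
rewrite (_ : beta = alpha + C) ?(mulrDl alpha C); last by rewrite /C; lra.
by apply: lerD; [exact: Flip|rewrite distrC; exact: fED].
Qed.


Theorem theorem3p4 (R : realType) (M : metricType R)
    (X : completeNormedModType R) (alpha : R) (phi : M -> set X)
    (alpha_ge0 : 0 <= alpha)
    (phi_nonempty : forall a, phi a !=set0)
    (phi_closed : forall a, closed (phi a))
    (phi_convex : forall a, convex_set (phi a))
    (phi_local :
      local_strongly_pointwise_lipschitz_selections alpha phi) :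
  ((exists f : M -> X, continuous f /\ is_selection phi f) ->
    forall beta : R, alpha < beta ->
      exists f : M -> X,
        [/\ continuous f, is_selection phi f
          & exists S : set M, dense S /\ pointwise_lipschitz_on beta f S])
  /\
  ((exists f : M -> X,
      [/\ continuous f, is_selection phi f & bounded_fun f]) ->
    forall beta : R, alpha < beta ->
      exists f : M -> X,
        [/\ continuous f, is_selection phi f, bounded_fun f
          & exists S : set M, dense S /\ pointwise_lipschitz_on beta f S]).
Proof.
split=> [[f0 [f0C f0phi]] beta ab|[f0 [f0C f0phi f0b]] beta ab];
  have [f [fC fphi ff0 fS]] := dense_lipschitz_selection
    alpha_ge0 ab phi_closed phi_convex phi_local f0C f0phi.
  by exists f.
exists f; split => //.
(* [bounded_fun] gives a bound for [f0] only by reals strictly above [K], whence [K + 1]. *)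
have [K [Kreal KP]] := f0b; exists (K + 1 + (beta - alpha)).
split; first exact: num_real.
move=> L KL x _ /=; rewrite -(subrK (f0 x) (f x)).
have f0K : `|f0 x| <= K + 1 by apply: KP => //; rewrite ltrDl.
have := ff0 x; have := ler_normD (f x - f0 x) (f0 x); lra.
Qed.
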